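(* If $f\in F_{\mathcal{OP}^3}$ is quasi-multiplicative and $g\in F_{\mathcal{OP}^2}$ is adapted, then the convolution $f\mathbin{\triangle} g\in F_{\mathcal{OP}^2}$ is adapted, and with $\underline z=(z_1,z_2,\dots)$ $$\underline Z_{f\mathbin{\triangle} g}(\underline z)=\underline Z_g\big(Z_f^{(1)}(z_1),Z_f^{(2)}(z_2),\dots\big).$$
   Context: Ordered set partitions. $\mathbb N=\{1,2,\dots\}$, $[n]=\{1,\dots,n\}$. An ordered set partition of $[n]$ is a sequence $\pi=(P_1,\dots,P_p)$ of pairwise disjoint nonempty blocks with union $[n]$; $|\pi|=p$; $\mathcal{OP}_n$ is the set of them; $\bar\pi$ is the underlying set partition; set partitions are ordered by refinement. For $\pi=(P_1,\dots,P_p)$, $\sigma=(S_1,\dots,S_s)$ we write $\pi\le\sigma$ iff $\bar\pi\le\bar\sigma$ and, whenever $i<j$, $P_i\subseteq S_k$, $P_j\subseteq S_l$, one has $k\le l$; $[\sigma,\pi]=\{\rho:\sigma\le\rho\le\pi\}$. For $\sigma\le\pi=(P_1,\dots,P_p)$ the type of $[\sigma,\pi]$ is $(k_1,\dots,k_p)$, $k_i$ the number of blocks of $\sigma$ contained in $P_i$. Function spaces. $F_{\mathcal{OP}^m}$ is the set of $\mathbb C$-valued functions on the set of $m$-chains $\sigma_1\le\cdots\le\sigma_m$ in $\mathcal{OP}_n$, $n$ ranging over $\mathbb N$. $\mathbb N_{\mathrm{fin}}^\infty=\bigcup_{p\ge1}\mathbb N^p$. $f\in F_{\mathcal{OP}^2}$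 is adapted if there is a defining family $(f_{\underline k})_{\underline k\in\mathbb N_{\mathrm{fin}}^\infty}\subseteq\mathbb C$ with $f(\sigma,\pi)=f_{k_1,\dots,k_p}$ whenever $[\sigma,\pi]$ has type $(k_1,\dots,k_p)$. Its multivariate generating function is $\underline Z_f(\underline z)=\sum_{\underline k\in\mathbb N_{\mathrm{fin}}^\infty}f_{\underline k}\,\underline z^{\underline k}$, where $\underline z^{\underline k}=z_1^{k_1}\cdots z_p^{k_p}$ for $\underline k=(k_1,\dots,k_p)$ and $z_1,z_2,\dots$ are commuting indeterminates. $f\in F_{\mathcal{OP}^3}$ is quasi-multiplicative if there is a defining array $(f_{jk})_{j,k\ge1}\subseteq\mathbb C$ with $f(\sigma,\rho,\pi)=\prod_{i=1}^p\prod_{R\in\rho,\,R\subseteq P_i}f_{i,\,k(R)}$ for $\sigma\le\rho\le\pi=(P_1,\dots,P_p)$, where $k(R)$ is the number of blocks of $\sigma$ contained in the block $R$ of $\rho$. Its generating functions are $Z_f^{(j)}(z)=\sum_{k=1}^\infty f_{jk}z^k$, $j\in\mathbb N$. For $f\in F_{\mathcal{OP}^3}$, $g\in F_{\mathcal{OP}^2}$: $(f\mathbin{\triangle} g)(\sigma,\pi)=\sum_{\rho\in[\sigma,\pi]}f(\sigma,\rho,\pi)\,g(\rho,\pi)$ for $\sigma\le\pi$. *)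

(* Defs.v *)
From HB Require Import structures.
From mathcomp Require Import all_boot all_order all_algebra.

Set Implicit Arguments.
Unset Strict Implicit.
Unset Printing Implicit Defensive.

Import GRing.Theory.

Local Open Scope ring_scope.

Section OrderedSetPartitions.
Variable n : nat.

Definition is_osp (s : seq {set 'I_n}) : bool :=
  uniq s && finset.partition [set:: s] [set: 'I_n].

Record osp := Osp { osp_blocks :> seq {set 'I_n}; _ : is_osp osp_blocks }.

HB.instance Definition _ := [isSub for osp_blocks].
HB.instance Definition _ := [Countable of osp by <:].

Lemma osp_size_subproof (s : osp) : (size s <= n)%N.
Proof.
case: s => s /= /andP[us /and3P[/eqP cov tri n0]].
have /card_uniqP <- := us; rewrite -[leqRHS]card_ord -cardsT.
move: (tri) => /eqP; rewrite cov => <-.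
have -> : #|s| = #|[set:: s]| by apply: eq_card => A; rewrite inE.
rewrite -sum1_card; apply: leq_sum => A sA; rewrite card_gt0.
by apply: contra n0 => /eqP <-.
Qed.

Definition osp_bseq (s : osp) : n.-bseq {set 'I_n} :=
  Bseq (osp_size_subproof s).

Lemma osp_bseqK : pcancel osp_bseq (fun b => insub (b : seq _)).
Proof. by move=> s; rewrite /= valK. Qed.

HB.instance Definition _ := isFinite.Build osp (pcan_enumP osp_bseqK).

Definition underlying (s : osp) : {set {set 'I_n}} := [set:: osp_blocks s].

Definition block (s : osp) (i : nat) : {set 'I_n} := nth set0 s i.

Definition refines (P Q : {set {set 'I_n}}) : bool :=
  [forall A in P, [exists B in Q, A \subset B]].

(* [p] is the finer partition. *)
Definition osp_le (p s : osp) : bool :=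
  refines (underlying p) (underlying s) &&
  [forall i : 'I_(size p), forall j : 'I_(size p),
   forall k : 'I_(size s), forall l : 'I_(size s),
     [&& (i < j)%N, block p i \subset block s k
              & block p j \subset block s l] ==> (k <= l)%N].

Definition nblocks_in (s : osp) (A : {set 'I_n}) : nat :=
  count (fun S : {set 'I_n} => S \subset A) s.

Definition osp_type (s p : osp) : seq nat := [seq nblocks_in s P | P <- p].

End OrderedSetPartitions.

Definition osp_itv n (s p : osp n) := {r : osp n | osp_le s r && osp_le r p}.

Section OspItv.
Variables (n : nat) (s p : osp n) (r : osp_itv s p).
Fact osp_itv_ge : osp_le s (val r). Proof. by case/andP: (valP r). Qed.
Fact osp_itv_le : osp_le (val r) p. Proof. by case/andP: (valP r). Qed.
End OspItv.

(* Chains live in ordered set partitions of a nonempty set: the set [n] with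
   n >= 1 is encoded as ['I_(n.-1).+1]. *)
Section FunctionSpaces.
Variable K : comNzRingType.

Definition F_OP2 := forall (n : nat) (s p : osp n.+1), osp_le s p -> K.

Definition F_OP3 := forall (n : nat) (s r p : osp n.+1),
  osp_le s r -> osp_le r p -> K.

(* Only the values of [a] on nonempty sequences of positive integers matter. *)
Definition defining_family (f : F_OP2) (a : seq nat -> K) : Prop :=
  forall (n : nat) (s p : osp n.+1) (sp : osp_le s p), f n s p sp = a (osp_type s p).

Definition adapted (f : F_OP2) : Prop :=
  exists a : seq nat -> K, defining_family f a.

(* Blocks are numbered from 0: [a i k] is the entry of the array with first
   index i + 1 and second index k; the values [a i 0] are irrelevant. *)
Definition defining_array (f : F_OP3) (a : nat -> nat -> K) : Prop :=
  forall (n : nat) (s r p : osp n.+1) (sr : osp_le s r) (rp : osp_le r p),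
    f n s r p sr rp =
    \prod_(i < size p) \prod_(B <- r | B \subset block p i)
      a i (nblocks_in s B).

Definition quasi_multiplicative (f : F_OP3) : Prop :=
  exists a : nat -> nat -> K, defining_array f a.

Definition conv (f : F_OP3) (g : F_OP2) : F_OP2 := fun n s p _ =>
  \sum_(r : osp_itv s p)
    f n s (val r) p (osp_itv_ge r) (osp_itv_le r) * g n (val r) p (osp_itv_le r).

End FunctionSpaces.

(* Imported only here: classical sets shadow the finite-set notation used above. *)
From mathcomp Require Import finmap.
From mathcomp Require Import boolp classical_sets functions cardinality fsbigop.
From mathcomp Require Import monalg.

Local Open Scope classical_set_scope.

Section FactorPairs.
Variable I : choiceType.
Implicit Types m : {cmonom I}.

Definition factor_pairs m : set ({cmonom I} * {cmonom I}) :=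
  [set p | mmul p.1 p.2 = m].

Lemma finite_factor_pairs m : finite_set (factor_pairs m).
Proof.
pose T := {ffun finsupp m -> 'I_(mdeg m).+1}.
pose mk (g : T) : {cmonom I} :=
  [cmonom (if insub i is Some j then nat_of_ord (g j) else 0%N) | i in finsupp m]%M.
have key (u v : {cmonom I}) : mmul u v = m -> exists g, mk g = u.
  move=> uv; exists [ffun j => inord (u (val j))].
  apply/eqP/cmP => i; rewrite cmE /= fsfun_fun; case: ifPn => im; last first.
    by apply/esym/eqP; move: im; rewrite -uv -cmE_eq0 cmM addn_eq0 => /andP[].
  rewrite insubT /= ffunE inordK //= ltnS mdegE (big_fsetD1 i) //= -uv cmM.
  by rewrite -addnA leq_addr.
apply: (@sub_finite_set _ _ ((fun g : T * T => (mk g.1, mk g.2)) @` setT)).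
  move=> [u v] uv; have {}uv : mmul u v = m := uv; have [g gu] := key _ _ uv.
  by rewrite mulmC in uv; have [h hv] := key _ _ uv; exists (g, h) => //=; congr pair.
exact/finite_image/finite_finset.
Qed.

End FactorPairs.

(* Formal power series over [K] in countably many commuting indeterminates
   z_1, z_2, ...: arbitrary coefficients on the monomials; z_(i+1) has index i. *)
Section PowerSeries.
Variable K : comNzRingType.

Record fps := Fps { fps_coef : {cmonom nat} -> K }.

HB.instance Definition _ := [isNew for fps_coef].
HB.instance Definition _ := [Choice of fps by <:].

Implicit Types a b c : fps.

Lemma fpsP a b : (forall m, fps_coef a m = fps_coef b m) <-> a = b.
Proof.
split=> [|->//]; case: a b => [a] [b] /= ab.
by congr Fps; apply/funext.
Qed.

Definition fps_zero := Fps (fun=> 0).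
Definition fps_opp a := Fps (fun m => - fps_coef a m).
Definition fps_add a b := Fps (fun m => fps_coef a m + fps_coef b m).
Definition fps_scale (k : K) a := Fps (fun m => k * fps_coef a m).
Definition fps_one := Fps (fun m => (m == mone)%:R).
Definition fps_mul a b := Fps (fun m =>
  \sum_(p \in factor_pairs m) fps_coef a p.1 * fps_coef b p.2).

Fact fps_addA : associative fps_add.
Proof. by move=> a b c; apply/fpsP => m /=; rewrite addrA. Qed.
Fact fps_addC : commutative fps_add.
Proof. by move=> a b; apply/fpsP => m /=; rewrite addrC. Qed.
Fact fps_add0 : left_id fps_zero fps_add.
Proof. by move=> a; apply/fpsP => m /=; rewrite add0r. Qed.
Fact fps_addN : left_inverse fps_zero fps_opp fps_add.
Proof. by move=> a; apply/fpsP => m /=; rewrite addNr. Qed.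

HB.instance Definition _ :=
  GRing.isZmodule.Build fps fps_addA fps_addC fps_add0 fps_addN.

Lemma fps_coef_mul a b m :
  fps_coef (fps_mul a b) m =
  \sum_(p <- fset_set (factor_pairs m)) fps_coef a p.1 * fps_coef b p.2.
Proof. by rewrite /= fsbig_finite //; exact: finite_factor_pairs. Qed.

Lemma mem_factor_pairs (m : {cmonom nat}) p :
  (p \in fset_set (factor_pairs m)) = (mmul p.1 p.2 == m).
Proof.
rewrite in_fset_set; last exact: finite_factor_pairs.
by apply/idP/eqP => [/set_mem|/mem_set].
Qed.

Fact fps_mulC : commutative fps_mul.
Proof.
move=> a b; apply/fpsP => m; rewrite !fps_coef_mul.
under eq_bigr do rewrite mulrC.
rewrite [LHS](_ : _ = \sum_(p <- [seq (p.2, p.1) | p <- fset_set (factor_pairs m)])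
   fps_coef b p.1 * fps_coef a p.2); last by rewrite big_map /=.
apply: perm_big; apply: uniq_perm; rewrite ?fset_uniq //.
  by rewrite map_inj_uniq ?fset_uniq // => -[u v] [u' v'] [-> ->].
move=> [u v]; apply/mapP/idP.
  by move=> [[u' v']] + [-> ->]; rewrite !mem_factor_pairs /= mulmC.
move=> uv; exists (v, u) => //.
by move: uv; rewrite !mem_factor_pairs /= mulmC.
Qed.

Fact fps_mulA : associative fps_mul.
Proof.
move=> a b c; apply/fpsP => m; rewrite !fps_coef_mul.
under eq_bigr do rewrite fps_coef_mul mulr_sumr.
under [RHS]eq_bigr do rewrite fps_coef_mul mulr_suml.
pose F (t : {cmonom nat} * {cmonom nat} * {cmonom nat}) :=
  fps_coef a t.1.1 * fps_coef b t.1.2 * fps_coef c t.2.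
pose FP (d : {cmonom nat}) : seq _ := fset_set (factor_pairs d).
pose L := [seq (p.1, q.1, q.2) | p <- FP m, q <- FP p.2].
pose R := [seq (q.1, q.2, p.2) | p <- FP m, q <- FP p.1].
transitivity (\sum_(t <- L) F t).
  rewrite big_allpairs_dep /=; apply: eq_bigr => p _.
  by apply: eq_bigr => q _; rewrite /F /= mulrA.
transitivity (\sum_(t <- R) F t); last by rewrite big_allpairs_dep.
apply: perm_big; apply: uniq_perm.
- apply: allpairs_uniq_dep => [|p _|]; rewrite ?fset_uniq //.
  move=> _ _ /allpairsPdep[p [q [pm qp ->]]] /allpairsPdep[p' [q' [pm' qp' ->]]] /=.
  case: p q p' q' pm qp pm' qp' => [p1 p2] [q1 q2] [p1' p2'] [q1' q2'] /=.
  rewrite !mem_factor_pairs /= => _ /eqP <- _ /eqP <-.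
  by case=> -> -> ->.
- apply: allpairs_uniq_dep => [|p _|]; rewrite ?fset_uniq //.
  move=> _ _ /allpairsPdep[p [q [pm qp ->]]] /allpairsPdep[p' [q' [pm' qp' ->]]] /=.
  case: p q p' q' pm qp pm' qp' => [p1 p2] [q1 q2] [p1' p2'] [q1' q2'] /=.
  rewrite !mem_factor_pairs /= => _ /eqP <- _ /eqP <-.
  by case=> -> -> ->.
move=> [[u v] w]; apply/allpairsPdep/allpairsPdep => /=.
  move=> [[p1 p2] [[q1 q2]]]; rewrite !mem_factor_pairs /=.
  move=> [/eqP pm /eqP qp [-> -> ->]].
  by exists (mmul p1 q1, q2), (p1, q1); rewrite !mem_factor_pairs /= -mulmA qp pm !eqxx.
move=> [[p1 p2] [[q1 q2]]]; rewrite !mem_factor_pairs /=.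
move=> [/eqP pm /eqP qp [-> -> ->]].
by exists (q1, mmul q2 p2), (q2, p2); rewrite !mem_factor_pairs /= mulmA qp pm !eqxx.
Qed.

Fact fps_mul1 : left_id fps_one fps_mul.
Proof.
move=> a; apply/fpsP => m; rewrite fps_coef_mul.
rewrite (big_fsetD1 (mone, m)) /=; last by rewrite mem_factor_pairs /= mul1m.
rewrite eqxx mul1r big_seq big1 ?addr0 // => -[u v].
rewrite in_fsetD1 mem_factor_pairs => /andP[ne /eqP uv].
rewrite -[RHS](mul0r (fps_coef a v)); congr (_ * _) => /=.
case: (eqVneq u mone) => // u1; case/eqP: ne.
by move: uv; rewrite u1 mul1m /= => ->.
Qed.

Fact fps_mulDl : left_distributive fps_mul fps_add.
Proof.
move=> a b c; apply/fpsP => m; rewrite [RHS]/= -/(fps_mul _ _) !fps_coef_mul.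
rewrite -[X in X + _]/(fps_coef (fps_mul a c) m).
rewrite -[X in _ + X]/(fps_coef (fps_mul b c) m) !fps_coef_mul -big_split.
by apply: eq_bigr => p _ /=; rewrite mulrDl.
Qed.

Fact fps_one_neq0 : fps_one != fps_zero.
Proof.
apply/eqP => /fpsP /(_ mone) /=.
by rewrite eqxx => /eqP; rewrite oner_eq0.
Qed.

HB.instance Definition _ := GRing.Zmodule_isComNzRing.Build fps
  fps_mulA fps_mulC fps_mul1 fps_mulDl fps_one_neq0.

Fact fps_scaleA k l a : fps_scale k (fps_scale l a) = fps_scale (k * l) a.
Proof. by apply/fpsP => m /=; rewrite mulrA. Qed.
Fact fps_scale1 : left_id 1 fps_scale.
Proof. by move=> a; apply/fpsP => m /=; rewrite mul1r. Qed.
Fact fps_scaleDr : right_distributive fps_scale +%R.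
Proof. by move=> k a b; apply/fpsP => m /=; rewrite mulrDr. Qed.
Fact fps_scaleDl a : {morph fps_scale^~ a : k l / k + l}.
Proof. by move=> k l; apply/fpsP => m /=; rewrite mulrDl. Qed.

HB.instance Definition _ := GRing.Zmodule_isLmodule.Build K fps
  fps_scaleA fps_scale1 fps_scaleDr fps_scaleDl.

Definition fps_var (i : nat) : fps := Fps (fun m => (m == ucm i)%:R).

(* Sum of a family of series, taken coefficientwise. It is meaningful when, for
   each monomial, finitely many terms have a nonzero coefficient; a coefficient
   for which this fails gets the value 0. *)
Definition fps_sum (I : choiceType) (D : set I) (F : I -> fps) : fps :=
  Fps (fun m => \sum_(i \in D) fps_coef (F i) m).

Definition summable (I : choiceType) (D : set I) (F : I -> fps) : Prop :=
  forall m, finite_set [set i | D i /\ fps_coef (F i) m != 0].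

Definition genfun (a : nat -> K) (w : fps) : fps :=
  fps_sum [set k | (0 < k)%N] (fun k => a k *: w ^+ k).

Definition N_fin : set (seq nat) :=
  [set k | k <> [::] /\ all (fun j => 0 < j)%N k].

(* [mgenfun a w] substitutes [w i] for the indeterminate z_(i+1); the formal
   generating function of the family [a] itself is [mgenfun a fps_var]. *)
Definition mgenfun (a : seq nat -> K) (w : nat -> fps) : fps :=
  fps_sum N_fin (fun k => a k *: \prod_(i < size k) w i ^+ nth 0%N k i).

(* Both sums are well defined when the substituted series have no constant
   term. *)
Section Summability.

Definition fps_order_ge (d : nat) a : Prop :=
  forall m, (mdeg m < d)%N -> fps_coef a m = 0.

Lemma fps_order_geM d e a b :
  fps_order_ge d a -> fps_order_ge e b -> fps_order_ge (d + e) (a * b).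
Proof.
move=> oa ob m lt; rewrite fps_coef_mul big_seq big1 // => p.
rewrite mem_factor_pairs => /eqP pm; move: lt; rewrite -pm mdegM => lt.
have [lp|lp] := ltnP (mdeg p.1) d; first by rewrite oa // mul0r.
by rewrite ob ?mulr0 // -(ltn_add2l d); apply: leq_ltn_trans lt; rewrite leq_add2r.
Qed.

Lemma fps_order_geX w k : fps_order_ge 1 w -> fps_order_ge k (w ^+ k).
Proof.
move=> ow; elim: k => [//|k IH]; rewrite exprS -add1n.
exact: fps_order_geM.
Qed.

Lemma fps_order_ge1 w : fps_coef w mone = 0 -> fps_order_ge 1 w.
Proof. by move=> w0 m; rewrite ltnS leqn0 mdeg_eq0 => /eqP ->. Qed.

Lemma fps_order_ge_prod (w : nat -> fps) (e : nat -> nat) n :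
  (forall i, fps_order_ge 1 (w i)) ->
  fps_order_ge (\sum_(i < n) e i) (\prod_(i < n) w i ^+ e i).
Proof.
move=> ow; elim: n => [|n IH]; first by rewrite !big_ord0.
by rewrite !big_ord_recr; apply: fps_order_geM => //; exact: fps_order_geX.
Qed.

Lemma genfun_summable (a : nat -> K) (w : fps) : fps_coef w mone = 0 ->
  summable [set k | (0 < k)%N] (fun k => a k *: w ^+ k).
Proof.
move=> /fps_order_ge1 ow m; apply: (@sub_finite_set _ _ `I_(mdeg m).+1).
  move=> k [_ /=]; apply: contraR; rewrite ltnS -ltnNge => lt.
  by rewrite (fps_order_geX ow lt) mulr0.
exact: finite_II.
Qed.

Lemma genfun_coef0 (a : nat -> K) (w : fps) : fps_coef w mone = 0 ->
  fps_coef (genfun a w) mone = 0.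
Proof.
move=> /fps_order_ge1 ow; rewrite /= fsbig1 // => k k0.
by rewrite (fps_order_geX ow) ?mulr0 // mdeg1.
Qed.

Lemma fps_var_coef0 i : fps_coef (fps_var i) mone = 0.
Proof. by rewrite /= eq_sym cm1_eq1. Qed.

Lemma mgenfun_summable (a : seq nat -> K) (w : nat -> fps) :
  (forall i, fps_coef (w i) mone = 0) ->
  summable N_fin (fun k => a k *: \prod_(i < size k) w i ^+ nth 0%N k i).
Proof.
move=> w0 m; pose N := mdeg m.
apply: (@sub_finite_set _ _ ((fun b : N.-bseq 'I_N.+1 =>
    [seq nat_of_ord i | i <- (b : seq _)]) @` setT)); last first.
  exact/finite_image/finite_finset.
move=> k [[_ k0] nz].
have le_sum : (sumn k <= N)%N.
  rewrite leqNgt; apply: contra nz => lt; apply/eqP => /=.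
  have -> : \prod_(i < size k) w i ^+ nth 0%N k i =
            \prod_(i < size k) w i ^+ (nth 0%N k) i by [].
  rewrite (@fps_order_ge_prod w (nth 0%N k)) ?mulr0 //.
    by move=> i; exact: fps_order_ge1.
  by rewrite -(big_mkord xpredT (nth 0%N k)) -(big_nth 0%N xpredT id) -sumnE.
have le_size : (size k <= N)%N.
  apply: leq_trans le_sum; elim: k k0 {nz} => //= x k IH /andP[x0 /IH].
  by move=> le; rewrite -add1n leq_add.
have le_all : all (fun x => x < N.+1)%N k.
  apply/allP => x xk; rewrite ltnS; apply: leq_trans le_sum.
  by elim: k xk {nz k0 le_size} => //= y k IH; rewrite inE => /predU1P[->|/IH le];
    rewrite ?leq_addr // (leq_trans le) // leq_addl.
have sz : (size [seq inord x : 'I_N.+1 | x <- k] <= N)%N by rewrite size_map.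
exists (Bseq sz) => //=; rewrite -map_comp -[RHS]map_id.
by apply/eq_in_map => x xk /=; rewrite inordK //; exact: (allP le_all).
Qed.

End Summability.

End PowerSeries.

(* Main.v *)
Require Import Defs.
From mathcomp Require Import all_boot all_order all_algebra.

Set Implicit Arguments.
Unset Strict Implicit.
Unset Printing Implicit Defensive.

(** Fix [s <= p] and let [k] be the type of the interval.  Being coarser than [s]
means being obtained from the list [s] by merging consecutive blocks, so an
intermediate [r] is obtained by cutting, for each [i], the run of [k_i] blocks
of [s] inside the [i]-th block of [p] into consecutive nonempty runs.  Recording
the lengths of these runs turns [r] into a list [cs] of compositions, [cs_i]
being a composition of [k_i], and this is a bijection from the interval onto all
such lists: [flatten cs] is the type of [[s, r]], hence determines [r]
([osp_type_inj]), and every [cs] occurs ([two_level_surj]).  In these terms the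
summand of the convolution is [weight a cs * b (shape cs)], where [shape cs], the
list of the lengths of the [cs_i], is the type of [[r, p]].  Thus the convolution
depends on [k] only, its family being [conv_family] ([conv_defining_family]).

For the generating functions, expanding the product of powers of the series
[Z_i = genfun (a i) (v i)] with exponents [l_i] gives the sum of
[weight a cs *: \prod_i v_i ^ (sumn cs_i)] over all lists [cs] of compositions
with [shape cs = l] ([monomial_at_genfun]).  Both sides of the identity are
therefore the single sum over all [cs] of
[b (shape cs) * weight a cs *: \prod_i v_i ^ (sumn cs_i)]: grouping by [shape cs]
gives the substitution into the generating function of [b], and grouping by
[map sumn cs] gives that of [conv_family a b].  This works for any series [v_i]
without constant term, since only finitely many [cs] then contribute to a given
coefficient ([mgenfun_conv_family]).

Finally a defining family of the convolution is only determined on sequences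
that are types of intervals; [osp_type_onto] shows that these are all the
nonempty sequences of positive integers, the only ones that the generating
function reads. *)

(** * Cutting a sequence into runs *)

Lemma filter_head_key (T : eqType) (phi : T -> nat) a (s : seq T) :
  pairwise (relpre phi leq) s -> all (fun x => a <= phi x) s ->
  s = [seq x <- s | phi x == a] ++ [seq x <- s | a < phi x].
Proof.
elim: s => //= x s IH /andP[xs sorts] /andP[ax sa].
case: ltngtP ax => //= [lt_ax|eq_ax] _; last by rewrite -IH.
rewrite (_ : filter _ s = [::]) /=.
  congr (_ :: _); apply/esym/all_filterP/allP => y ys.
  exact: leq_trans lt_ax (allP xs _ ys).
apply/eqP; rewrite -[_ == _]negbK -has_filter; apply/hasPn => y ys.
by rewrite neq_ltn (leq_trans lt_ax (allP xs _ ys)) orbT.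
Qed.

(** A sequence sorted by a key is the concatenation of its fibres, with the
original order kept inside each fibre. *)
Lemma pairwise_key_flatten (T : eqType) (phi : T -> nat) n a (s : seq T) :
  pairwise (relpre phi leq) s -> all (fun x => a <= phi x < a + n) s ->
  s = flatten [seq [seq x <- s | phi x == k] | k <- iota a n].
Proof.
elim: n a s => [|n IH] a s sorts sa /=.
  case: s sa {sorts} => //= x s /andP[/andP[]]; rewrite addn0 => le lt.
  by move: (leq_ltn_trans le lt); rewrite ltnn.
rewrite {1}(@filter_head_key _ phi a s) //; last first.
  by apply: sub_all sa => x /andP[].
congr (_ ++ _); rewrite {1}[filter _ _](IH a.+1); first 1 last.
- exact: pairwise_filter.
- rewrite all_filter; apply: sub_all sa => x /andP[_ lt].
  by apply/implyP => /= ->; rewrite addSnnS.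
congr flatten; apply/eq_in_map => k; rewrite mem_iota => /andP[ak _].
rewrite -filter_predI; apply: eq_filter => x /=.
by case: eqP => // ->.
Qed.

Lemma uniq_flatten_mem (T : eqType) (ss : seq (seq T)) x b c :
  uniq (flatten ss) -> b \in ss -> c \in ss -> x \in b -> x \in c -> b = c.
Proof.
move=> + bss; case/splitPr: bss => ss1 ss2.
rewrite flatten_cat /= !cat_uniq => /and3P[_ /hasPn nb1 /and3P[_ /hasPn nb2 _]].
rewrite mem_cat inE => /or3P[c1|/eqP->//|c2] xb xc; exfalso.
  move: (nb1 x); rewrite mem_cat xb => /(_ isT) /flattenP[].
  by exists c.
have /nb2 : x \in flatten ss2 by apply/flattenP; exists c.
by rewrite /= xb.
Qed.

Lemma uniq_flatten_blocks (T : eqType) (ss : seq (seq T)) :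
  uniq (flatten ss) -> [::] \notin ss -> uniq ss.
Proof.
elim: ss => //= b ss IH; rewrite cat_uniq inE negb_or => /and3P[_ nb /IH{}IH].
move=> /andP[b0 /IH ->]; rewrite andbT; apply: contra nb => bss.
case: b b0 bss => // x b _ bss; apply/hasP; exists x; last exact: mem_head.
by apply/flattenP; exists (x :: b) => //; exact: mem_head.
Qed.

(** * Unions of lists of sets *)

Section SetSequences.
Variable T : finType.
Implicit Types (A B S : {set T}) (s r b : seq {set T}) (ss : seq (seq {set T})).

Definition bigU s : {set T} := \bigcup_(A <- s) A.

Lemma bigUP x s : reflect (exists2 A, A \in s & x \in A) (x \in bigU s).
Proof.
rewrite /bigU; elim: s => [|B s IH].
  by rewrite big_nil inE; constructor => -[].
rewrite big_cons inE; apply: (iffP orP) => [[xB|/IH[A As xA]]|[A]].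
- by exists B; rewrite ?mem_head.
- by exists A; rewrite // inE As orbT.
by rewrite inE => /predU1P[->|As xA]; [left|right; apply/IH; exists A].
Qed.

Lemma bigU_flatten ss : bigU [seq bigU b | b <- ss] = bigU (flatten ss).
Proof.
apply/setP => x; apply/bigUP/bigUP.
  move=> [_ /mapP[b bss ->] /bigUP[A Ab xA]]; exists A => //.
  by apply/flattenP; exists b.
move=> [A /flattenP[b bss Ab] xA]; exists (bigU b); first exact: map_f.
by apply/bigUP; exists A.
Qed.

Lemma sub_bigU A b : A \in b -> A \subset bigU b.
Proof. by move=> Ab; apply/subsetP => x xA; apply/bigUP; exists A. Qed.

Definition groups s r := [seq [seq S : {set T} <- s | S \subset B] | B : {set T} <- r].

End SetSequences.

(** * Coarsening as merging of consecutive blocks *)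

Section OspTheory.
Variable n : nat.
Implicit Types (s r p : osp n) (A B S : {set 'I_n}).

Lemma is_ospP (s : seq {set 'I_n}) :
  reflect [/\ uniq s, set0 \notin s, bigU s = setT &
           {in s &, forall A B x, x \in A -> x \in B -> A = B}] (is_osp s).
Proof.
have covE : cover [set:: s] = bigU s.
  apply/setP => x; apply/bigcupP/bigUP => -[A].
    by rewrite inE => As xA; exists A.
  by move=> As xA; exists A; rewrite ?inE.
apply: (iffP andP) => [[us /and3P[/eqP cov /trivIsetP tri n0]]|[us n0 cov inj]].
  split; rewrite ?inE // in n0 *; first by rewrite -covE.
  move=> A B As Bs x xA xB; apply/eqP; apply: contraT => AB.
  have := tri A B; rewrite !inE => /(_ As Bs AB) /pred0P /(_ x) /=.
  by rewrite xA xB.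
split=> //; apply/and3P; split; rewrite ?covE ?cov ?inE //.
apply/trivIsetP => A B; rewrite !inE => As Bs; apply: contraNT => /pred0Pn[x /=].
by move=> /andP[xA xB]; apply/eqP; apply: inj xB.
Qed.

Lemma osp_uniq s : uniq s. Proof. by case: s => s /= /is_ospP[]. Qed.
Lemma osp_bigU s : bigU s = setT. Proof. by case: s => s /= /is_ospP[]. Qed.
Lemma osp_inj s : {in osp_blocks s &, forall A B x, x \in A -> x \in B -> A = B}.
Proof. by case: s => s /= /is_ospP[]. Qed.
Lemma osp_neq0 s A : A \in osp_blocks s -> exists x, x \in A.
Proof.
case: s => s /= /is_ospP[_ n0 _ _] As; apply/set0Pn.
by apply: contra n0 => /eqP <-.
Qed.

Lemma osp_sub_eq s r S A B : S \in osp_blocks s ->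
  A \in osp_blocks r -> B \in osp_blocks r -> S \subset A -> S \subset B -> A = B.
Proof.
move=> /osp_neq0[x xS] Ar Br /subsetP/(_ _ xS) xA /subsetP/(_ _ xS) xB.
exact: osp_inj Ar Br _ xA xB.
Qed.

Lemma osp_leP s r :
  reflect ((forall S, S \in osp_blocks s ->
             exists2 B, B \in osp_blocks r & S \subset B) /\
           (forall i j k l, i < j -> j < size s -> k < size r -> l < size r ->
             nth set0 s i \subset nth set0 r k ->
             nth set0 s j \subset nth set0 r l -> k <= l))
    (osp_le s r).
Proof.
apply: (iffP andP) => [[/'forall_in_'exists_in_idP ref mon]|[ref mon]]; split.
- move=> S Ss; have [|B Br SB] := ref S; first by rewrite inE.
  by exists B => //; rewrite inE in Br.
- move=> i j k l ij js kr lr ik jl.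
  move/forallP/(_ (Ordinal (ltn_trans ij js))): mon.
  move/forallP/(_ (Ordinal js))/forallP/(_ (Ordinal kr))/forallP/(_ (Ordinal lr)).
  by move=> /implyP; apply; apply/and3P.
- apply/'forall_in_'exists_in_idP => S; rewrite inE => /ref[B Br SB].
  by exists B => //; rewrite inE.
apply/forallP => i; apply/forallP => j; apply/forallP => k; apply/forallP => l.
apply/implyP => /and3P[ij ik jl].
exact: (mon i j k l).
Qed.

(** Sending a block of [s] to the position of the block of [r] that contains it
is nondecreasing along [s], by the order condition in [osp_le]; the groups are
the fibres of this map. *)
Lemma flatten_groups s r : osp_le s r -> flatten (groups s r) = s.
Proof.
move=> /osp_leP[ref mon]; pose phi S := find (fun B => S \subset B) r.
have hasr S : S \in osp_blocks s -> has (fun B => S \subset B) r.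
  by move=> /ref[B Br SB]; apply/hasP; exists B.
have sub_phi S : S \in osp_blocks s -> S \subset nth set0 r (phi S).
  by move=> /hasr/(nth_find set0).
rewrite [RHS](@pairwise_key_flatten _ phi (size r) 0).
- congr flatten; rewrite /groups -{1}(mkseq_nth set0 r) -map_comp.
  apply/eq_in_map => k; rewrite mem_iota => /andP[_ kr] /=.
  apply/eq_in_filter => S Ss; apply/idP/eqP => [Sk|<-]; last exact: sub_phi.
  apply/eqP; rewrite -(nth_uniq set0 _ _ (osp_uniq r)) -?has_find ?hasr //.
  apply/eqP; apply: (@osp_sub_eq s r S _ _ Ss) => //;
    rewrite ?mem_nth -?has_find ?hasr //.
  exact: sub_phi.
- apply/(pairwiseP set0) => i j /[!inE] ilt jlt ij /=.
  apply: (mon i j) => //; rewrite -?has_find ?hasr ?mem_nth //;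
    exact/sub_phi/mem_nth.
by apply/allP => S Ss; rewrite leq0n add0n -has_find hasr.
Qed.

Lemma bigU_groups s r : osp_le s r -> [seq bigU b | b <- groups s r] = r.
Proof.
move=> /osp_leP[ref _]; rewrite -map_comp -[RHS]map_id.
apply/eq_in_map => B Br /=; apply/setP => x; apply/bigUP/idP.
  by move=> [S]; rewrite mem_filter => /andP[/subsetP SB _ /SB].
move=> xB; have : x \in bigU s by rewrite osp_bigU inE.
move=> /bigUP[S Ss xS]; have [B' B'r SB'] := ref _ Ss.
exists S => //; rewrite mem_filter Ss andbT.
by rewrite (osp_inj Br B'r xB) // (subsetP SB').
Qed.

Lemma osp_typeE s r : osp_type s r = shape (groups s r).
Proof.
by rewrite /osp_type /shape -map_comp; apply: eq_map => B; rewrite /= size_filter.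
Qed.

(** The blocks of [s] are nonempty and disjoint, so a block contained in a union of
blocks is one of them. *)
Lemma filter_bigU s (ss : seq (seq {set 'I_n})) b : flatten ss = s -> b \in ss ->
  [seq S : {set _} <- osp_blocks s | S \subset bigU b] = b.
Proof.
move=> fss bss; have us := osp_uniq s.
have inb S : S \in osp_blocks s -> (S \subset bigU b) = (S \in b).
  move=> Ss; apply/idP/idP => [Sb|]; last exact: sub_bigU.
  have [x xS] := osp_neq0 Ss.
  have /bigUP[A Ab xA] : x \in bigU b by exact: (subsetP Sb).
  have As : A \in osp_blocks s by rewrite -fss; apply/flattenP; exists b.
  by rewrite (osp_inj Ss As xS xA).
rewrite (eq_in_filter inb) -fss; rewrite -fss in us.
case/splitPr: bss us => ss1 ss2; rewrite flatten_cat /= !cat_uniq.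
move=> /and3P[_ nb1 /and3P[_ nb2 _]].
have no c : ~~ has (mem b) c -> filter (mem b) c = [::].
  by rewrite has_filter negbK => /eqP.
rewrite !filter_cat [filter _ (flatten ss1)]no; last first.
  apply: contra nb1 => /hasP[S S1 Sb]; apply/hasP; exists S => //=.
  by rewrite mem_cat; apply/orP; left.
rewrite [filter _ (flatten ss2)]no; last first.
  by apply: contra nb2 => /hasP[S S1 Sb]; apply/hasP; exists S.
by rewrite cats0 /=; apply/all_filterP/allP.
Qed.

Lemma groups_bigU s (ss : seq (seq {set 'I_n})) : flatten ss = s ->
  groups s [seq bigU b | b <- ss] = ss.
Proof.
move=> fss; rewrite /groups -map_comp -[RHS]map_id.
by apply/eq_in_map => b bss /=; exact: filter_bigU fss bss.
Qed.

(** With [groups_bigU] and [osp_le_bigU]: merging the consecutive runs of any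
factorisation of [s] into nonempty runs gives an ordered set partition above
[s], and the runs are recovered as its groups. *)
Lemma is_osp_bigU s (ss : seq (seq {set 'I_n})) : flatten ss = s ->
  [::] \notin ss -> is_osp [seq bigU b | b <- ss].
Proof.
move=> fss n0; have us := osp_uniq s; rewrite -fss in us; apply/is_ospP; split.
- rewrite map_inj_in_uniq ?uniq_flatten_blocks // => b c bss css bc.
  by rewrite -(filter_bigU fss bss) bc (filter_bigU fss css).
- apply/mapP => -[[|A b] bss Ub0]; first by rewrite bss in n0.
  have As : A \in osp_blocks s.
    by rewrite -fss; apply/flattenP; exists (A :: b); rewrite ?mem_head.
  have [x xA] := osp_neq0 As; have := sub_bigU (mem_head A b).
  by rewrite -Ub0 => /subsetP /(_ _ xA); rewrite inE.
- by rewrite bigU_flatten fss osp_bigU.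
move=> _ _ /mapP[b bss ->] /mapP[c css ->] x /bigUP[A Ab xA] /bigUP[B Bc xB].
have As : A \in osp_blocks s by rewrite -fss; apply/flattenP; exists b.
have Bs : B \in osp_blocks s by rewrite -fss; apply/flattenP; exists c.
rewrite -(osp_inj As Bs xA xB) in Bc.
by rewrite (uniq_flatten_mem us bss css Ab Bc).
Qed.

Lemma osp_le_bigU s r (ss : seq (seq {set 'I_n})) :
  flatten ss = s -> [seq bigU b | b <- ss] = r -> osp_le s r.
Proof.
move=> fss ssr; apply/osp_leP; split=> [S|i j k l ij js].
  rewrite -fss -ssr => /flattenP[b bss Sb]; exists (bigU b); last exact: sub_bigU.
  exact: map_f.
rewrite -ssr size_map => kss lss; rewrite !(nth_map [::]) // => ik jl.
rewrite leqNgt; apply/negP => lk; have is_ := ltn_trans ij js.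
have us := osp_uniq s.
have ib : nth set0 s i \in nth [::] ss k.
  by rewrite -(filter_bigU fss (mem_nth _ kss)) mem_filter ik mem_nth.
have jb : nth set0 s j \in nth [::] ss l.
  by rewrite -(filter_bigU fss (mem_nth _ lss)) mem_filter jl mem_nth.
(* As [l < k], the list [s] is cut before the run [k]: then [j] falls before the
   cut and [i] after it, against [i < j]. *)
have sE : osp_blocks s = flatten (take k ss) ++ flatten (drop k ss).
  by rewrite -flatten_cat cat_take_drop.
have jt : nth set0 s j \in flatten (take k ss).
  apply/flattenP; exists (nth [::] ss l) => //.
  by rewrite -(nth_take _ lk) mem_nth // size_take kss.
have id : nth set0 s i \in flatten (drop k ss).
  apply/flattenP; exists (nth [::] ss k) => //.
  by rewrite -{1}[k]addn0 -nth_drop mem_nth // size_drop subn_gt0.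
have /negP it : nth set0 s i \notin flatten (take k ss).
  move: us; rewrite {1}sE cat_uniq => /and3P[_ /hasPn/(_ _ id)] //.
have ltj : j < size (flatten (take k ss)).
  by rewrite -(index_uniq set0 js us) [X in index _ X]sE index_cat jt index_mem.
have lei : size (flatten (take k ss)) <= i.
  rewrite -(index_uniq set0 is_ us) [X in index _ X]sE index_cat ifN; last exact/negP.
  exact: leq_addr.
by have := leq_ltn_trans lei (ltn_trans ij ltj); rewrite ltnn.
Qed.

Lemma osp_type_gt0 s r : osp_le s r -> all (leq 1) (osp_type s r).
Proof.
move=> /osp_leP[ref _]; apply/allP => _ /mapP[B Br ->].
rewrite -has_count; have [x xB] := osp_neq0 Br.
have /bigUP[S Ss xS] : x \in bigU s by rewrite osp_bigU inE.
have [B' B'r SB'] := ref _ Ss; apply/hasP; exists S => //.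
by rewrite (osp_inj Br B'r xB) // (subsetP SB').
Qed.

Lemma osp_le_groups s r : osp_le s r ->
  osp_blocks r = [seq bigU b | b <- reshape (osp_type s r) s].
Proof.
move=> sr; rewrite osp_typeE.
by rewrite -{2}(flatten_groups sr) flattenK bigU_groups.
Qed.

Lemma osp_type_inj s r r' : osp_le s r -> osp_le s r' ->
  osp_type s r = osp_type s r' -> r = r'.
Proof.
by move=> sr sr' e; apply: val_inj; rewrite /= (osp_le_groups sr) e -osp_le_groups.
Qed.

(** The list of compositions that encodes [r] as an element of the interval
[[s, p]]: its [i]-th entry is the type of the part of [r] inside the [i]-th block
of [p]. *)
Definition two_level_type s r p : seq (seq nat) :=
  [seq [seq nblocks_in s R | R <- b] | b <- groups r p].

Lemma flatten_two_level s r p : osp_le r p ->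
  flatten (two_level_type s r p) = osp_type s r.
Proof. by move=> rp; rewrite -map_flatten flatten_groups. Qed.

Lemma shape_two_level s r p : shape (two_level_type s r p) = osp_type r p.
Proof.
by rewrite osp_typeE /shape -map_comp; apply: eq_map => b; rewrite /= size_map.
Qed.

Lemma sumn_two_level s r p : osp_le s r -> osp_le r p ->
  map sumn (two_level_type s r p) = osp_type s p.
Proof.
move=> sr rp; have /osp_leP[refs _] := sr; have /osp_leP[refr _] := rp.
rewrite -!map_comp; apply/eq_in_map => P Pp /=.
rewrite /nblocks_in -[X in _ = count _ X](flatten_groups sr) count_flatten -map_comp.
rewrite !sumnE !big_map big_filter big_mkcond /=.
apply: eq_big_seq => R Rr; rewrite count_filter; case: ifPn => RP.
  apply/eq_count => S /=; case: (boolP (S \subset R)) => [SR|]; last by rewrite andbF.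
  by rewrite (subset_trans SR).
apply/esym/eqP; rewrite -leqn0 leqNgt -has_count; apply/hasPn => S Ss /=.
apply: contra RP => /andP[SP SR]; have [P' P'p RP'] := refr _ Rr.
by rewrite (@osp_sub_eq s p S _ _ Ss Pp P'p) // (subset_trans SR).
Qed.

Lemma two_level_gt0 s r p : osp_le s r -> osp_le r p ->
  all (all (leq 1)) (two_level_type s r p).
Proof.
move=> sr rp; have := osp_type_gt0 sr; rewrite -(flatten_two_level s rp).
by elim: two_level_type => //= c cs IH; rewrite all_cat => /andP[-> /IH].
Qed.

Lemma two_level_reshape (T : Type) (cs : seq (seq nat)) (pp : seq (seq T)) :
  shape pp = map sumn cs ->
  exists2 rr : seq (seq (seq T)), map flatten rr = pp & map shape rr = cs.
Proof.
elim: cs pp => [|c cs IH] [|b pp] //= => [_|[bc /IH[rr <- <-]]]; first by exists [::].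
exists (reshape c b :: rr) => /=; first by rewrite reshapeKr ?bc.
by rewrite reshapeKl ?bc.
Qed.

(** Cut the group of [s] under each block of [p] along [cs]: merging the innermost
runs gives [r], and merging its blocks group by group gives back [p]. *)
Lemma two_level_surj s p (cs : seq (seq nat)) : osp_le s p ->
  all (all (leq 1)) cs -> map sumn cs = osp_type s p ->
  exists r, [/\ osp_le s r, osp_le r p & two_level_type s r p = cs].
Proof.
move=> sp cs0 csE.
have [|rr rrpp rrcs] := @two_level_reshape _ cs (groups s p).
  by rewrite -osp_typeE csE.
have frr : flatten (flatten rr) = s.
  rewrite -(flatten_groups sp) -rrpp.
  by elim: (rr) => //= c l IH; rewrite flatten_cat IH.
have nrr : [::] \notin flatten rr.
  apply/flattenP => -[c crr nc]; have := map_f shape crr; rewrite rrcs => /(allP cs0).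
  by move=> /allP /(_ _ (map_f size nc)).
pose r := Osp (is_osp_bigU frr nrr).
have prr : [seq bigU b | b <- [seq [seq bigU b | b <- c] | c <- rr]] = p.
  rewrite -(bigU_groups sp) -rrpp -!map_comp; apply: eq_map => c /=.
  by rewrite bigU_flatten.
have fr : flatten [seq [seq bigU b | b <- c] | c <- rr] = r by rewrite -map_flatten.
have sr : osp_le s r by exact: (@osp_le_bigU s r _ frr (erefl _)).
have rp : osp_le r p by exact: (osp_le_bigU fr prr).
exists r; split=> //; apply: eq_from_flatten_shape.
  rewrite flatten_two_level // osp_typeE (groups_bigU frr) -rrcs.
  by rewrite /shape map_flatten.
rewrite shape_two_level osp_typeE -prr (groups_bigU fr) -rrcs /shape -!map_comp.
by apply: eq_map => c /=; rewrite !size_map.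
Qed.

End OspTheory.

(** The witness is the partition of a set with [sumn k] elements into singletons,
merged into runs of lengths [k]. *)
Lemma osp_type_onto (k : seq nat) : k <> [::] -> all (leq 1) k ->
  exists n (s p : osp n.+1), osp_le s p /\ osp_type s p = k.
Proof.
move=> k0 kp; have sk : (0 < sumn k)%N by case: k k0 kp => //= -[].
exists (sumn k).-1; rewrite prednK //; move nE: (sumn k) => n.
pose s0 : seq {set 'I_n} := [seq [set i] | i <- enum 'I_n].
have s0P : is_osp s0.
  apply/is_ospP; split.
  - by rewrite map_inj_uniq ?enum_uniq //; exact: set1_inj.
  - by apply/mapP => -[i _ /setP /(_ i)]; rewrite !inE eqxx.
  - apply/setP => i; rewrite inE; apply/bigUP; exists [set i]; rewrite ?inE //.
    by apply: map_f; rewrite mem_enum.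
  by move=> _ _ /mapP[i _ ->] /mapP[j _ ->] x /set1P <- /set1P <-.
pose s := Osp s0P.
have sz : size s = sumn k by rewrite size_map size_enum_ord nE.
have fs : flatten (reshape k s) = s by rewrite reshapeKr // sz.
have shs : shape (reshape k s) = k by rewrite reshapeKl // sz.
have ns : [::] \notin reshape k s.
  by apply/negP => /(map_f size); rewrite -/(shape _) shs => /(allP kp).
exists s, (Osp (is_osp_bigU fs ns)); split.
  exact: (@osp_le_bigU _ s (Osp _) _ fs (erefl _)).
by rewrite osp_typeE (groups_bigU fs).
Qed.

(* Classical sets shadow the finite-set notation used so far. *)
From mathcomp Require Import finmap.
From mathcomp Require Import boolp classical_sets functions cardinality fsbigop.
From mathcomp Require Import monalg.
From mathcomp Require Import reals complex.
Import GRing.Theory.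
Local Open Scope ring_scope.
Local Open Scope classical_set_scope.

(** * The defining family of the convolution *)

Section Convolution.
Variable K : comNzRingType.
Implicit Types (a : nat -> nat -> K) (b : seq nat -> K) (cs : seq (seq nat)).

(** The value of a quasi-multiplicative function with array [a] on the chain
encoded by [cs]. *)
Definition weight a cs : K := \prod_(i < size cs) \prod_(x <- nth [::] cs i) a i x.

(** The sum runs over the lists of compositions of the entries of [k]. *)
Definition conv_family a b (k : seq nat) : K :=
  \sum_(cs \in [set cs | all (all (leq 1)) cs /\ map sumn cs = k])
    weight a cs * b (shape cs).

Lemma weight_two_level a n (s r p : osp n) :
  \prod_(i < size p) \prod_(B <- r | B \subset block p i) a i (nblocks_in s B) =
  weight a (two_level_type s r p).
Proof.
rewrite /weight !size_map; apply: eq_bigr => i _.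
rewrite (nth_map [::]) ?size_map // (nth_map finset.set0) // big_map big_filter.
by [].
Qed.

Lemma conv_defining_family (f : F_OP3 K) (g : F_OP2 K) a b :
  defining_array f a -> defining_family g b ->
  defining_family (conv f g) (conv_family a b).
Proof.
move=> fa gb n s p sp; rewrite /conv /conv_family.
pose h (r : osp_itv s p) := two_level_type s (val r) p.
rewrite (@reindex_fsbig _ _ _ _ _ h setT); last first.
  split=> [r _ /=|r r' _ _ hr|cs /= [cs0 csE]].
  - split; first exact: two_level_gt0 (osp_itv_ge r) (osp_itv_le r).
    exact: sumn_two_level (osp_itv_ge r) (osp_itv_le r).
  - apply/val_inj/(osp_type_inj (osp_itv_ge r) (osp_itv_ge r')).
    by rewrite -!(flatten_two_level s (osp_itv_le _)) -/(h r) hr.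
  have [r [sr rp rE]] := two_level_surj sp cs0 csE.
  have srp : osp_le s r && osp_le r p by rewrite sr.
  by exists (exist _ r srp).
have -> : [set: osp_itv s p] = [set` (xpredT : pred (osp_itv s p))].
  by apply/seteqP; split.
rewrite -(@bigfs _ _ _ _ (index_enum _)) ?index_enum_uniq //.
  by apply: eq_bigr => r _; rewrite fa gb weight_two_level shape_two_level.
by move=> r _; rewrite mem_index_enum.
Qed.

End Convolution.

(** * Summable families of power series *)

Section PowerSeriesSums.
Variable K : comNzRingType.
Local Notation fps := (fps K).

(** Each coefficient of a sum is a sum over any list containing the contributing
indices; every identity between infinite sums below is reduced to finite lists
in this way. *)
Lemma fps_sum_coef (I : choiceType) (D : set I) (F : I -> fps) m (s : seq I) :
  uniq s -> (forall i, D i -> fps_coef (F i) m != 0 -> i \in s) ->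
  fps_coef (fps_sum D F) m = \sum_(i <- s | i \in D) fps_coef (F i) m.
Proof.
move=> us sP /=; rewrite fsbig_mkcond.
have -> : [set: I] = [set` (xpredT : pred I)] by apply/seteqP; split.
rewrite -(@bigfs _ _ _ _ s) // => [|i _].
  by rewrite [RHS]big_mkcond.
rewrite /patch; case: ifPn => // /[!inE] Di; apply: contraNeq => nz.
exact: sP.
Qed.

(** A single list has to serve finitely many coefficients at once, because one
coefficient of a product involves several coefficients of the factors. *)
Lemma summable_seq (I : choiceType) (D : set I) (F : I -> fps)
    (ms : seq {cmonom nat}) : summable D F ->
  exists2 s : seq I, uniq s &
    forall m, m \in ms -> forall i, D i -> fps_coef (F i) m != 0 -> i \in s.
Proof.
move=> sF; elim: ms => [|m ms [s us IH]]; first by exists [::].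
exists (undup (fset_set [set i | D i /\ fps_coef (F i) m != 0] ++ s)).
  exact: undup_uniq.
move=> m' m'ms i Di nz; rewrite mem_undup mem_cat.
move: m'ms nz; rewrite inE => /predU1P[-> nz|/IH sP nz]; last by rewrite sP ?orbT.
by rewrite in_fset_set ?mem_set //; exact: sF.
Qed.

Lemma summable_seq1 (I : choiceType) (D : set I) (F : I -> fps) m : summable D F ->
  exists2 s : seq I, uniq s & forall i, D i -> fps_coef (F i) m != 0 -> i \in s.
Proof.
move=> /(summable_seq [:: m])[s us sP]; exists s => // i.
by apply: sP; rewrite mem_head.
Qed.

Lemma summable_order (I : choiceType) (D : set I) (F : I -> fps) (e : I -> nat) :
  (forall i, D i -> fps_order_ge (e i) (F i)) ->
  (forall d, finite_set [set i | D i /\ (e i <= d)%N]) -> summable D F.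
Proof.
move=> oF fin m; apply: sub_finite_set (fin (mdeg m)) => i [Di nz]; split=> //.
by rewrite leqNgt; apply: contra nz => lt; rewrite (oF i).
Qed.

Lemma fps_coefZ (k : K) (w : fps) m : fps_coef (k *: w) m = k * fps_coef w m.
Proof. by []. Qed.

Lemma fps_order_geZ d (k : K) (w : fps) : fps_order_ge d w -> fps_order_ge d (k *: w).
Proof. by move=> ow m lt; rewrite /= ow ?mulr0. Qed.

Lemma fps_scaleM (k l : K) (u w : fps) : (k *: u) * (l *: w) = (k * l) *: (u * w).
Proof.
apply/fpsP => m; rewrite fps_coefZ !fps_coef_mul mulr_sumr.
by apply: eq_bigr => p _; rewrite !fps_coefZ mulrACA.
Qed.

Lemma eq_fps_sum (I : choiceType) (D : set I) (F G : I -> fps) :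
  (forall i, D i -> F i = G i) -> fps_sum D F = fps_sum D G.
Proof.
move=> FG; apply/fpsP => m /=; apply: eq_fsbigr => i /[!inE] Di.
by rewrite FG.
Qed.

Lemma fps_sum_set1 (I : choiceType) (i : I) (F : I -> fps) :
  fps_sum [set i] F = F i.
Proof. by apply/fpsP => m /=; rewrite fsbig_set1. Qed.

Lemma reindex_fps_sum (I J : choiceType) (D : set I) (E : set J) (h : I -> J)
  (F : J -> fps) : set_bij D E h -> fps_sum E F = fps_sum D (F \o h).
Proof. by move=> hb; apply/fpsP => m /=; rewrite (reindex_fsbig h D). Qed.

Lemma fps_sumZ (I : choiceType) (D : set I) (F : I -> fps) (k : K) : summable D F ->
  k *: fps_sum D F = fps_sum D (fun i => k *: F i).
Proof.
move=> sF; apply/fpsP => m; have [s us sP] := summable_seq1 m sF.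
rewrite fps_coefZ !(fps_sum_coef us) ?mulr_sumr // => i Di /=.
by move=> nz; apply: sP => //; apply: contra nz => /eqP ->; rewrite mulr0.
Qed.

Lemma fps_sumZl (I : choiceType) (D : set I) (x : I -> K) (w : fps) : finite_set D ->
  (\sum_(i \in D) x i) *: w = fps_sum D (fun i => x i *: w).
Proof.
by move=> Dfin; apply/fpsP => m /=; rewrite !fsbig_finite //= mulr_suml.
Qed.

Lemma fps_sumM (I J : choiceType) (D : set I) (E : set J) (F : I -> fps)
    (G : J -> fps) :
  summable D F -> summable E G ->
  fps_sum D F * fps_sum E G = fps_sum (D `*` E) (fun p => F p.1 * G p.2).
Proof.
move=> sF sG; apply/fpsP => m; pose FP : seq _ := fset_set (factor_pairs m).
have [s us sP] := summable_seq [seq p.1 | p <- FP] sF.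
have [t ut tP] := summable_seq [seq p.2 | p <- FP] sG.
rewrite (@fps_sum_coef _ _ _ _ [seq (i, j) | i <- s, j <- t]); first 1 last.
- by apply: allpairs_uniq => // -[? ?] [].
- move=> [i j] [/= Di Ej] nz; have {nz} : fps_coef (F i * G j) m != 0 := nz.
  rewrite fps_coef_mul -/FP => nz.
  have [p pFP] : exists2 p, p \in FP & fps_coef (F i) p.1 * fps_coef (G j) p.2 != 0.
    apply/hasP; apply: contraR nz => /hasPn z; rewrite big_seq big1 // => p /z.
    by rewrite negbK => /eqP.
  move=> pnz; apply/allpairsP; exists (i, j); split=> //=.
    apply: (sP p.1); rewrite ?map_f //.
    by apply: contra pnz => /eqP ->; rewrite mul0r.
  apply: (tP p.2); rewrite ?map_f //.
  by apply: contra pnz => /eqP ->; rewrite mulr0.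
rewrite fps_coef_mul -/FP [RHS]big_mkcond big_allpairs.
transitivity (\sum_(p <- FP) \sum_(i <- s | i \in D) \sum_(j <- t | j \in E)
    fps_coef (F i) p.1 * fps_coef (G j) p.2).
  apply: eq_big_seq => p pFP; rewrite -big_distrlr.
  rewrite (fps_sum_coef us) ?(fps_sum_coef ut) // => i; [apply: tP|apply: sP];
    exact: map_f.
rewrite exchange_big [LHS]big_mkcond; apply: eq_bigr => i _.
rewrite exchange_big [X in if _ then X else _]big_mkcond /=.
case: ifPn => iD; last first.
  by rewrite big1 // => j _; rewrite ifN // in_setX (negbTE iD).
apply: eq_bigr => j _; have -> : ((i, j) \in D `*` E) = (j \in E).
  by rewrite in_setX iD.
by rewrite -fps_coef_mul.
Qed.

(** Fubini for the fibres of [h]. *)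
Lemma fps_sum_partition (I J : choiceType) (D : set I) (E : set J) (h : I -> J)
    (F : I -> fps) : summable D F -> (forall i, D i -> E (h i)) ->
  fps_sum E (fun j => fps_sum [set i | D i /\ h i = j] F) = fps_sum D F.
Proof.
move=> sF hE; apply/fpsP => m; have [s us sP] := summable_seq1 m sF.
have innerE j : fps_coef (fps_sum [set i | D i /\ h i = j] F) m =
    \sum_(i <- s | (i \in D) && (h i == j)) fps_coef (F i) m.
  rewrite (fps_sum_coef us) => [|i [Di _]]; last exact: sP.
  apply: eq_bigl => i; apply/idP/andP; rewrite !inE /=.
    by move=> [Di ->].
  by move=> [Di /eqP].
rewrite (fps_sum_coef us sP).
rewrite (@fps_sum_coef _ _ _ _ (undup (map h s))) ?undup_uniq //; last first.
  move=> j Ej; rewrite innerE mem_undup => nz.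
  have /hasP[i is_ /andP[_ /eqP <-]] : has (fun i => (i \in D) && (h i == j)) s.
    by apply: contraR nz => /hasPn z; rewrite big_seq_cond big1 // => i /andP[/z/negP].
  exact: map_f.
under eq_bigr do rewrite innerE.
rewrite (exchange_big_dep (mem D)) //=; last by move=> j i _ /andP[].
rewrite big_seq_cond [RHS]big_seq_cond; apply: eq_bigr => i /andP[is_ iD].
have hi : h i \in undup (map h s) by rewrite mem_undup map_f.
have Eh : h i \in E by rewrite mem_set //; apply: hE; rewrite inE in iD.
rewrite big_mkcond (bigD1_seq (h i)) ?undup_uniq //=.
rewrite Eh iD eqxx big1 ?addr0 // => j jh.
by rewrite [h i == j]eq_sym (negbTE jh) !andbF.
Qed.

End PowerSeriesSums.

(** * Finiteness of the lists of compositions of bounded size *)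

Section PositiveSequences.

Lemma size_le_sumn (c : seq nat) : all (leq 1) c -> (size c <= sumn c)%N.
Proof.
elim: c => //= x c IH /andP[x0 /IH le]; rewrite -add1n.
exact: leq_add.
Qed.

Lemma finite_pos_seq d : finite_set [set c | all (leq 1) c /\ (sumn c <= d)%N].
Proof.
elim: d => [|d IH].
  apply: (@sub_finite_set _ _ [set [::]]); last exact: finite_set1.
  by move=> [|x c] //= [/andP[x0 _]]; rewrite leqn0 addn_eq0; case: x x0.
apply: (@sub_finite_set _ _ ([set [::]] `|`
  (fun p => p.1 :: p.2) @` (`I_d.+2 `*` [set c | all (leq 1) c /\ (sumn c <= d)%N]))).
  move=> [|x c] /=; first by left.
  move=> [/andP[x0 c0] le]; right; exists (x, c) => //=; split=> /=.
    by rewrite ltnS (leq_trans _ le) ?leq_addr.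
  by split=> //; rewrite -ltnS (leq_trans _ le) // -add1n leq_add2r.
rewrite finite_setU; split; first exact: finite_set1.
by apply/finite_image/finite_setX => //; exact: finite_II.
Qed.

(** A list of lists is determined by its shape and its concatenation. *)
Lemma finite_shape (A : set (seq nat)) d : finite_set A ->
  finite_set [set cs | all (all (leq 1)) cs /\
    A (shape cs) /\ (sumn (map sumn cs) <= d)%N].
Proof.
move=> Afin; apply: (@sub_finite_set _ _ ((fun p => reshape p.1 p.2) @`
  (A `*` [set c | all (leq 1) c /\ (sumn c <= d)%N]))); last first.
  by apply/finite_image/finite_setX => //; exact: finite_pos_seq.
move=> cs [cs0 [Acs le]]; exists (shape cs, flatten cs); last exact: flattenK.
split=> //; split=> /=; last by rewrite sumn_flatten.
by elim: (cs) cs0 => //= c l IH /andP[c0 /IH]; rewrite all_cat c0.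
Qed.

Lemma finite_two_level d : finite_set [set cs | all (all (leq 1)) cs /\
  N_fin (shape cs) /\ (sumn (map sumn cs) <= d)%N].
Proof.
apply: sub_finite_set (finite_shape d (finite_pos_seq d)) => cs [cs0 [[_ sh0] le]].
split=> //; split=> //; split=> //; apply: leq_trans le.
rewrite /shape; elim: (cs) cs0 => //= c l IH /andP[c0 /IH].
exact/leq_add/size_le_sumn.
Qed.

Lemma N_fin_sumn (cs : seq (seq nat)) : all (all (leq 1)) cs ->
  N_fin (map sumn cs) <-> N_fin (shape cs).
Proof.
move=> cs0; have e : all (leq 1) (map sumn cs) = all (leq 1) (shape cs).
  rewrite !all_map; apply/eq_in_all => c /(allP cs0) c0 /=.
  by case: c c0 => //= x c /andP[x0 _]; rewrite ltn_addr.
split=> -[n0 pos]; split; try by move=> nil; apply: n0; case: (cs) nil.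
  exact: etrans (esym e) pos.
exact: etrans e pos.
Qed.

End PositiveSequences.

(** * Substitution into generating functions *)

Section GeneratingFunctions.
Variable K : comNzRingType.
Local Notation fps := (fps K).
Implicit Types (a : nat -> nat -> K) (b : seq nat -> K) (v : nat -> fps).

Definition monomial_at v (k : seq nat) : fps := \prod_(i < size k) v i ^+ nth 0%N k i.

Lemma monomial_at_cons v x k :
  monomial_at v (x :: k) = v 0%N ^+ x * monomial_at (fun i => v i.+1) k.
Proof. by rewrite /monomial_at big_ord_recl. Qed.

Lemma weight_cons a c cs :
  weight a (c :: cs) = \prod_(x <- c) a 0%N x * weight (fun i => a i.+1) cs.
Proof. by rewrite /weight big_ord_recl. Qed.

Lemma monomial_at_order v k : (forall i, fps_coef (v i) mone = 0) ->
  fps_order_ge (sumn k) (monomial_at v k).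
Proof.
move=> v0; have := @fps_order_ge_prod _ v (nth 0%N k) (size k).
rewrite -(big_mkord xpredT (nth 0%N k)) -(big_nth 0%N xpredT id) -sumnE.
by apply=> i; exact: fps_order_ge1.
Qed.

Definition two_level_term a v cs : fps := weight a cs *: monomial_at v (map sumn cs).

Lemma summable_two_level a b v (D : set (seq (seq nat))) :
  (forall i, fps_coef (v i) mone = 0) ->
  (forall d, finite_set [set cs | D cs /\ (sumn (map sumn cs) <= d)%N]) ->
  summable D (fun cs => b (shape cs) *: two_level_term a v cs).
Proof.
move=> v0 fin; apply: summable_order fin => cs _.
exact/fps_order_geZ/fps_order_geZ/monomial_at_order.
Qed.

(** Prepending the first part of a composition: [genfun a w ^+ l.+1] ranges over
pairs of a part and a composition with [l] parts. *)
Lemma genfun_exp (a : nat -> K) (w : fps) l : fps_coef w mone = 0 ->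
  genfun a w ^+ l = fps_sum [set c | all (leq 1) c /\ size c = l]
    (fun c => (\prod_(x <- c) a x) *: w ^+ sumn c).
Proof.
move=> w0; elim: l => [|l IH].
  have -> : [set c | all (leq 1) c /\ size c = 0%N] = [set [::]].
    by apply/seteqP; split=> [c [_ /size0nil]|c ->].
  by rewrite fps_sum_set1 big_nil !expr0 scale1r.
rewrite exprS IH /genfun fps_sumM; first 1 last.
- exact: genfun_summable.
- apply: (@summable_order _ _ _ _ sumn) => [c _|d].
    exact/fps_order_geZ/fps_order_geX/fps_order_ge1.
  by apply: sub_finite_set (finite_pos_seq d) => c /= [[c0 _] le].
rewrite [RHS](@reindex_fps_sum _ _ _ ([set k | (0 < k)%N] `*`
    [set c | all (leq 1) c /\ size c = l]) _ (fun p => p.1 :: p.2)).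
  apply: eq_fps_sum => -[k c] _ /=.
  by rewrite big_cons exprD fps_scaleM.
split=> [[k c] [/= k0 [c0 cl]]|[k c] [k' c'] _ _ [-> ->] //|].
  by rewrite k0 c0 cl.
move=> [|k c] [//= /andP[k0 c0] [cl]].
by exists (k, c).
Qed.

(** Induction on [l]; removing its head shifts the indices of [a] and [v], hence
the statement for all [a] and [v]. *)
Lemma monomial_at_genfun a v l : (forall i, fps_coef (v i) mone = 0) ->
  monomial_at (fun j => genfun (a j) (v j)) l =
  fps_sum [set cs | all (all (leq 1)) cs /\ shape cs = l] (two_level_term a v).
Proof.
elim: l a v => [|x l IH] a v v0.
  have -> : [set cs : seq (seq nat) | all (all (leq 1)) cs /\ shape cs = [::]] =
      [set [::]].
    by apply/seteqP; split=> [[]//|c ->]; [move=> ? ? []|].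
  by rewrite fps_sum_set1 /two_level_term /weight /monomial_at !big_ord0 scale1r.
rewrite monomial_at_cons IH // genfun_exp // fps_sumM; first 1 last.
- apply: (@summable_order _ _ _ _ sumn) => [c _|d].
    exact/fps_order_geZ/fps_order_geX/fps_order_ge1.
  by apply: sub_finite_set (finite_pos_seq d) => c /= [[c0 _] le].
- apply: (@summable_order _ _ _ _ (fun cs => sumn (map sumn cs))) => [cs _|d].
    exact/fps_order_geZ/monomial_at_order.
  apply: sub_finite_set (finite_shape d (finite_set1 l)) => cs /= [[cs0 csl] le].
  by split.
rewrite [RHS](@reindex_fps_sum _ _ _ ([set c | all (leq 1) c /\ size c = x] `*`
    [set cs | all (all (leq 1)) cs /\ shape cs = l]) _ (fun p => p.1 :: p.2)).
  apply: eq_fps_sum => -[c cs] _ /=.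
  by rewrite fps_scaleM /two_level_term weight_cons monomial_at_cons.
split=> [[c cs] [/= [c0 cx] [cs0 csl]]|[c cs] [c' cs'] _ _ [-> ->] //|].
  by rewrite c0 cs0 cx csl.
move=> [|c cs] [//= /andP[c0 cs0] [cx csl]].
by exists (c, cs).
Qed.

(** Both sides are regroupings of one sum over the lists of nonempty compositions,
along [map sumn] and along [shape]. *)
Lemma mgenfun_conv_family a b v : (forall i, fps_coef (v i) mone = 0) ->
  mgenfun (conv_family a b) v = mgenfun b (fun j => genfun (a j) (v j)).
Proof.
move=> v0; pose CC := [set cs | all (all (leq 1)) cs /\ N_fin (shape cs)].
pose F cs := b (shape cs) *: two_level_term a v cs.
have sF : summable CC F.
  apply: summable_two_level v0 _ => d.
  by apply: sub_finite_set (finite_two_level d) => cs /= [[? ?] ?].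
transitivity (fps_sum CC F).
  rewrite -(@fps_sum_partition _ _ _ _ N_fin (map sumn)) //; last first.
    by move=> cs [cs0 /(N_fin_sumn cs0)].
  apply: eq_fps_sum => k kN.
  have -> : [set cs | CC cs /\ map sumn cs = k] =
      [set cs | all (all (leq 1)) cs /\ map sumn cs = k].
    apply/seteqP; split=> [cs [[]//]|cs [cs0 csk]]; split=> //; split=> //.
    by apply/(N_fin_sumn cs0); rewrite csk.
  rewrite -/(monomial_at v k) fps_sumZl; last first.
    apply: sub_finite_set (finite_two_level (sumn k)) => cs [cs0 csk]; split=> //.
    by split; [apply/(N_fin_sumn cs0); rewrite csk|rewrite csk].
  apply: eq_fps_sum => cs [_ csk].
  by rewrite /F /two_level_term csk scalerA mulrC.
rewrite -(@fps_sum_partition _ _ _ _ N_fin (@shape nat)) //; last by move=> cs [].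
apply: eq_fps_sum => l lN.
rewrite -[X in _ = _ *: X]/(monomial_at (fun j => genfun (a j) (v j)) l).
rewrite monomial_at_genfun //.
have -> : [set cs | CC cs /\ shape cs = l] =
    [set cs | all (all (leq 1)) cs /\ shape cs = l].
  by apply/seteqP; split=> [cs [[]//]|cs [cs0 csl]]; split=> //;
     split=> //; rewrite csl.
rewrite fps_sumZ.
  by apply: eq_fps_sum => cs [_ <-].
apply: (@summable_order _ _ _ _ (fun cs => sumn (map sumn cs))) => [cs _|d].
  exact/fps_order_geZ/monomial_at_order.
by apply: sub_finite_set (finite_shape d (finite_set1 l)) => cs [[cs0 csl] le].
Qed.

End GeneratingFunctions.

Local Open Scope complex_scope.

Theorem propositionA26 (R : realType) (f : F_OP3 R[i]) (g : F_OP2 R[i])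
  (f_qm : quasi_multiplicative f) (g_ad : adapted g) :
  adapted (conv f g) /\
  forall (fa : nat -> nat -> R[i]) (ga ha : seq nat -> R[i]),
    defining_array f fa -> defining_family g ga ->
    defining_family (conv f g) ha ->
    mgenfun ha (fps_var R[i]) =
    mgenfun ga (fun j => genfun (fa j) (fps_var R[i] j)).
Proof.
have [a fa] := f_qm; have [b gb] := g_ad.
split; first by exists (conv_family a b); exact: conv_defining_family.
move=> {fa gb} fa ga ha fP gP hP.
rewrite -mgenfun_conv_family; last exact: fps_var_coef0.
apply: eq_fps_sum => k [k0 kpos].
have [n [s [p [sp <-]]]] := osp_type_onto k0 kpos.
by rewrite -(hP n s p sp) (conv_defining_family fP gP).
Qed.
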